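(* Let $\phi_1,\dots,\phi_N$ be twice continuously differentiable on $\mathbb R^n$ with $\lambda_1I\preceq\nabla^2\phi_i(x)\preceq\lambda_nI$ for all $x\in\mathbb R^n$ and all $i$, where $0<\lambda_1<\lambda_n$, and let $x^*$ be the unique minimizer of $f_N$. Assume that $h:\mathbb N\to\mathbb R$ is monotone, strictly decreasing, with $h(1)>0$, $h(N)=0$. Let $\{x_k\}$ be generated by Algorithm IRETR invoked with $\varepsilon_g=0$ (not terminating finitely), with $B_{k+1}=\nabla^2f_{D_{k+1}}(x_k)=\frac1{D_{k+1}}\sum_{i\in I_{D_{k+1}}}\nabla^2\phi_i(x_k)$, $I_{D_{k+1}}\subseteq\{1,\dots,N\}$ random with $|I_{D_{k+1}}|=D_{k+1}\in[1,N]$, and with $p_k$ the global minimizer of $m_k$ over $\|p\|\le\Delta_k$, so that $(\nabla^2f_{D_{k+1}}(x_k)+\nu_kI)p_k=-\nabla f_N(x_k)$ for some $\nu_k\ge0$; assume $\{x_k\}$ is contained in a compact set $\Omega$. Assume that full precision for function and gradient has been reached, i.e. for all $k$ sufficiently large every model built at iteration $k$ is $m_k(p)=f_N(x_k)+\nabla f_N(x_k)^Tp+\frac12p^T\nabla^2f_{D_{k+1}}(x_k)p$ (that is, $N_k=N$ and only $N_{k+1}=N$ is used). Assume that $\nabla^2f_N$ is Lipschitz continuous with constant $2L_H$ on $\mathcal B_\delta(x^* )=\{x:\|x-x^*\|\le\delta\}$, that there exists $\nu^*\in(0,1)$ such that for all $k$ $$\frac{\nu_k}{\lambda_1+\nu_k}\le\nu^*,$$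 and that, for each $k$ and given $x_k$, the random Hessian sample satisfies $$P\bigl(\|\nabla^2f_N(x_k)-\nabla^2f_{D_{k+1}}(x_k)\|\le\chi_H\bigr)\ge1-p_H$$ with $\chi_H>0$, $p_H\in(0,1)$. Then there exist $\delta,\chi_H,p_H$ sufficiently small such that $$E(\|x_{k+1}-x^*\|)\le\bar\tau\,E(\|x_k-x^*\|)$$ for all $k$ large enough and some $\bar\tau\in(0,1)$.
   Context: Problem. Let $N,n\ge 1$ be integers and $\phi_1,\dots,\phi_N:\mathbb R^n\to\mathbb R$. For a nonempty $I_M\subseteq\{1,\dots,N\}$ with $|I_M|=M$ put $f_M(x)=\frac1M\sum_{i\in I_M}\phi_i(x)$; $f_N$ is the full average, to be minimized over $\mathbb R^n$. $\|\cdot\|$ is the Euclidean (operator 2-) norm; $A\preceq B$ means $B-A$ is positive semidefinite. $h:\mathbb N\to\mathbb R$ measures infeasibility with respect to the constraint $M=N$. Probability and expectation are with respect to the random choice of samples. Algorithm IRETR. Data: $x_0\in\mathbb R^n$, an integer $N_0\in(0,N]$, $\theta_0\in(0,1)$, $\Delta_0>0$, $0<\zeta_1<1<\zeta_2$, $\gamma\in(0,1]$, $r,\eta,\tau\in(0,1)$, $\mu\in[0,1)$, $\varepsilon_g\ge0$. Step 0. Set $k=0$, $\mathcal T_0=0$, $\Delta_0^{(0)}=\Delta_0$. Step 1. If $N_k<N$, find an integer $\widetilde N_{k+1}$ with $N_k<\widetilde N_{k+1}\le N$ and $h(\widetilde N_{k+1})\le r\,h(N_k)$. If $N_k=N$,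 set $\widetilde N_{k+1}=N$. Step 2. Choose an integer $1\le N_{k+1}\le\widetilde N_{k+1}$ with $h(N_{k+1})-h(\widetilde N_{k+1})\le\mu(\Delta_k^{(\mathcal T_k)})^{1+\gamma}$ and a sample $I_{N_{k+1}}$. If $N_k=N$ and $\|\nabla f_{N_{k+1}}(x_k)\|\le\varepsilon_g$, stop. Build the model $m_k(p)=f_{N_{k+1}}(x_k)+\nabla f_{N_{k+1}}(x_k)^Tp+\frac12p^TB_{k+1}p$ with $B_{k+1}\in\mathbb R^{n\times n}$ symmetric. Find $p_k$ with $\|p_k\|\le\Delta_k^{(\mathcal T_k)}$ and $m_k(0)-m_k(p_k)\ge\tau(m_k(0)-m_k(p_k^C))$, where the Cauchy step $p_k^C$ minimizes $m_k$ over $\{p=-t\nabla f_{N_{k+1}}(x_k):\ t>0,\ \|p\|\le\Delta_k^{(\mathcal T_k)}\}$. Step 3. If $N_k=N$, $N_{k+1}<N$ and $f_N(x_k)-m_k(p_k)<\tau(m_k(0)-m_k(p_k^C))$, set $\Delta_k^{(\mathcal T_k+1)}=\zeta_1\Delta_k^{(\mathcal T_k)}$, $\mathcal T_k=\mathcal T_k+1$ and repeat Step 2. Step 4. Set $\theta_{k+1}=\theta_k$ if $\mathrm{Pred}_k(\theta_k)\ge\eta(h(N_k)-h(\widetilde N_{k+1}))$; otherwise $\theta_{k+1}=\dfrac{(1-\eta)(h(N_k)-h(\widetilde N_{k+1}))}{m_k(p_k)-f_{N_k}(x_k)+h(N_k)-h(\widetilde N_{k+1})}$. Step 5. If $\mathrm{Ared}_k(\theta_{k+1})\ge\eta\,\mathrm{Pred}_k(\theta_{k+1})$,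 set $x_{k+1}=x_k+p_k$, $\Delta_k=\Delta_k^{(\mathcal T_k)}$, choose $\Delta_{k+1}^{(0)}\in[\Delta_k,\zeta_2\Delta_k]$, set $k=k+1$, $\mathcal T_k=0$ and go to Step 1. Otherwise set $\Delta_k^{(\mathcal T_k+1)}=\zeta_1\Delta_k^{(\mathcal T_k)}$, $\mathcal T_k=\mathcal T_k+1$ and go to Step 2. Here $\mathrm{Pred}_k(\theta)=\theta(f_{N_k}(x_k)-m_k(p_k))+(1-\theta)(h(N_k)-h(\widetilde N_{k+1}))$ and $\mathrm{Ared}_k(\theta)=\theta(f_{N_k}(x_k)-f_{N_{k+1}}(x_k+p_k))+(1-\theta)(h(N_k)-h(N_{k+1}))$. When $N_k=N_{k+1}=N$ the acceptance test in Step 5 reads $f_N(x_k)-f_N(x_k+p_k)\ge\eta(m_k(0)-m_k(p_k))$. *)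

(* Defs.v *)
From HB Require Import structures.
From mathcomp Require Import all_boot all_order all_algebra.
From mathcomp Require Import all_classical all_reals all_analysis.

Set Implicit Arguments.
Unset Strict Implicit.
Unset Printing Implicit Defensive.

Import Order.TTheory GRing.Theory Num.Theory.
Import numFieldNormedType.Exports.

Local Open Scope classical_set_scope.
Local Open Scope ring_scope.

(* Points of R^n are row vectors, as in the library's ['J]; matrices act on the
   right.  The library norm on ['rV_n] is the sup norm, hence [enorm]. *)

Section Euclidean.
Context {R : realType} {n : nat}.
Implicit Types (u v x : 'rV[R]_n) (A B : 'M[R]_n) (f : 'rV[R]_n -> R).

Definition dotv u v : R := (u *m v^T) 0 0.

Definition enorm u : R := Num.sqrt (\sum_(i < n) u 0 i ^+ 2).

(* [v |-> v *m A] and [v |-> A *m v] have the same operator 2-norm. *)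
Definition opnorm A : R :=
  sup [set enorm (v *m A) | v in [set v : 'rV[R]_n | enorm v <= 1]].

Definition psd A : Prop := A^T = A /\ forall v, 0 <= dotv (v *m A) v.

Definition loewner_le A B : Prop := psd (B - A).

Definition grad f x : 'rV[R]_n := \row_(j < n) 'D_(delta_mx 0 j) f x.

Definition hess f x : 'M[R]_n := 'J (grad f) x.

Definition C2 f : Prop :=
  [/\ forall x, differentiable f x,
      forall x, differentiable (grad f) x
    & continuous (hess f)].

Definition unique_minimizer f x : Prop :=
  (forall y, f x <= f y) /\ (forall z, (forall y, f z <= f y) -> z = x).

Definition hess_lipschitz_on_ball f c (delta L : R) : Prop :=
  forall x y, enorm (x - c) <= delta -> enorm (y - c) <= delta ->
    opnorm (hess f x - hess f y) <= L * enorm (x - y).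

End Euclidean.

Section Data.
Context {R : realType} {n : nat}.

Record iretr_data := IretrData {
  ini_x : 'rV[R]_n;
  ini_N : nat;
  ini_theta : R;
  ini_Delta : R;
  par_zeta1 : R;
  par_zeta2 : R;
  par_gamma : R;
  par_r : R;
  par_eta : R;
  par_tau : R;
  par_mu : R;
  par_eps_g : R }.

Definition valid_data (N : nat) (a : iretr_data) : Prop :=
  [/\ (0 < ini_N a <= N)%N /\ 0 < ini_theta a < 1,
      0 < ini_Delta a,
      0 < par_zeta1 a < 1 /\ 1 < par_zeta2 a,
      0 < par_gamma a <= 1 /\
      [/\ 0 < par_r a < 1, 0 < par_eta a < 1 & 0 < par_tau a < 1]
    & 0 <= par_mu a < 1 /\ 0 <= par_eps_g a].

End Data.

Arguments iretr_data : clear implicits.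

Section Algorithm.
Context {R : realType} {N n : nat}.
Variable phi : 'I_N -> 'rV[R]_n -> R.
Implicit Types (S : {set 'I_N}) (x p q g : 'rV[R]_n) (B : 'M[R]_n).

Definition favg S x : R := #|S|%:R^-1 * \sum_(i in S) phi i x.

Definition ffull : 'rV[R]_n -> R := favg [set: 'I_N]%SET.

Definition model S x B p : R :=
  favg S x + dotv (grad (favg S) x) p + 2^-1 * dotv (p *m B) p.

Definition cauchy_arc g (Delta : R) : set 'rV[R]_n :=
  [set p | (exists2 t : R, 0 < t & p = - (t *: g)) /\ enorm p <= Delta].

Definition is_minimizer_on (C : set 'rV[R]_n) (m : 'rV[R]_n -> R) p : Prop :=
  C p /\ forall q, C q -> m p <= m q.

(* An infinite execution.  Quantities carrying two indices [k t] are those of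
   the pass through Steps 2-5 made at outer iteration [k] with counter
   T_k = t; [tr_T k] is the value of the counter at acceptance, so only the
   passes t <= tr_T k are meaningful.  An index k+1 of the algorithm that denotes
   a quantity built during iteration k is stored at index k:
   - [tr_I k] is the sample I_{N_k} attached to x_k, so N_k = #|tr_I k|;
   - [tr_Ntilde k] is N~_{k+1};
   - [tr_Inew k t] is the trial sample I_{N_{k+1}}, and [tr_B k t] is B_{k+1}. *)
Record trace := Trace {
  tr_x : nat -> 'rV[R]_n;
  tr_I : nat -> {set 'I_N};
  tr_Ntilde : nat -> nat;
  tr_theta : nat -> R;
  tr_T : nat -> nat;
  tr_Delta : nat -> nat -> R;
  tr_Inew : nat -> nat -> {set 'I_N};
  tr_B : nat -> nat -> 'M[R]_n;
  tr_pC : nat -> nat -> 'rV[R]_n;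
  tr_p : nat -> nat -> 'rV[R]_n }.

Section Steps.
Variables (h : nat -> R) (a : iretr_data R n) (s : trace).
Implicit Types (k t : nat) (th : R).

Definition tr_N k : nat := #|tr_I s k|.
Definition tr_Nnew k t : nat := #|tr_Inew s k t|.

Definition tr_m k t : 'rV[R]_n -> R :=
  model (tr_Inew s k t) (tr_x s k) (tr_B s k t).

Definition predk k t th : R :=
  th * (favg (tr_I s k) (tr_x s k) - tr_m k t (tr_p s k t))
  + (1 - th) * (h (tr_N k) - h (tr_Ntilde s k)).

Definition aredk k t th : R :=
  th * (favg (tr_I s k) (tr_x s k)
        - favg (tr_Inew s k t) (tr_x s k + tr_p s k t))
  + (1 - th) * (h (tr_N k) - h (tr_Nnew k t)).

Definition step0 : Prop :=
  [/\ tr_x s 0%N = ini_x a, tr_N 0%N = ini_N a, tr_theta s 0%N = ini_theta a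
    & tr_Delta s 0%N 0%N = ini_Delta a].

Definition step1 k : Prop :=
  if (tr_N k < N)%N then
    (tr_N k < tr_Ntilde s k <= N)%N /\ h (tr_Ntilde s k) <= par_r a * h (tr_N k)
  else tr_Ntilde s k = N.

(* The third clause says that the stopping test does not fire. *)
Definition step2 k t : Prop :=
  [/\ (1 <= tr_Nnew k t <= tr_Ntilde s k)%N,
      h (tr_Nnew k t) - h (tr_Ntilde s k)
        <= par_mu a * (tr_Delta s k t `^ (1 + par_gamma a)),
      ~ (tr_N k = N /\
         enorm (grad (favg (tr_Inew s k t)) (tr_x s k)) <= par_eps_g a),
      (tr_B s k t)^T = tr_B s k t
    & [/\ enorm (tr_p s k t) <= tr_Delta s k t,
          is_minimizer_on
            (cauchy_arc (grad (favg (tr_Inew s k t)) (tr_x s k))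
                        (tr_Delta s k t))
            (tr_m k t) (tr_pC s k t)
        & par_tau a * (tr_m k t 0 - tr_m k t (tr_pC s k t))
            <= tr_m k t 0 - tr_m k t (tr_p s k t)]].

Definition step3_rejects k t : Prop :=
  [/\ tr_N k = N, (tr_Nnew k t < N)%N
    & ffull (tr_x s k) - tr_m k t (tr_p s k t)
        < par_tau a * (tr_m k t 0 - tr_m k t (tr_pC s k t))].

Definition step4_theta k t : R :=
  let dh := h (tr_N k) - h (tr_Ntilde s k) in
  if par_eta a * dh <= predk k t (tr_theta s k) then tr_theta s k
  else (1 - par_eta a) * dh
       / (tr_m k t (tr_p s k t) - favg (tr_I s k) (tr_x s k) + dh).

Definition step5_accepts k t : Prop :=
  if (tr_N k == N) && (tr_Nnew k t == N) then
    par_eta a * (tr_m k t 0 - tr_m k t (tr_p s k t))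
      <= ffull (tr_x s k) - ffull (tr_x s k + tr_p s k t)
  else
    par_eta a * predk k t (step4_theta k t) <= aredk k t (step4_theta k t).

Definition failed_pass k t : Prop :=
  (step3_rejects k t \/ ~ step5_accepts k t)
  /\ tr_Delta s k t.+1 = par_zeta1 a * tr_Delta s k t.

Definition successful_pass k t : Prop :=
  [/\ ~ step3_rejects k t, step5_accepts k t,
      tr_x s k.+1 = tr_x s k + tr_p s k t,
      tr_I s k.+1 = tr_Inew s k t /\ tr_theta s k.+1 = step4_theta k t
    & tr_Delta s k t <= tr_Delta s k.+1 0%N <= par_zeta2 a * tr_Delta s k t].

Definition is_iretr_run : Prop :=
  step0 /\ forall k,
    [/\ step1 k,
        forall t, (t <= tr_T s k)%N -> step2 k t,
        forall t, (t < tr_T s k)%N -> failed_pass k t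
      & successful_pass k (tr_T s k)].

End Steps.

End Algorithm.

Arguments trace : clear implicits.

Section Probability.
Context {R : realType} {n : nat} {d : measure_display} {T : measurableType d}.
Implicit Types (X : T -> 'rV[R]_n).

Definition random_vector X : Prop :=
  forall i, measurable_fun [set: T] (fun w => X w 0 i).

Definition sigma_generated X : set (set T) :=
  <<s [set E | exists i, exists2 B : set R, measurable B
                       & E = (fun w => X w 0 i) @^-1` B] >>.

(* [Y] is a version of the conditional probability P(G | X). *)
Definition is_cond_prob (P : probability T R) X (G : set T) (Y : T -> R) :
    Prop :=
  [/\ measurable G,
      forall B : set R, measurable B -> sigma_generated X (Y @^-1` B),
      P.-integrable [set: T] (EFin \o Y)
    & forall E, sigma_generated X E ->
        (\int[P]_(w in E) (Y w)%:E = P (G `&` E))%E].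

Definition cond_prob_ge (P : probability T R) X (G : set T) (c : R) : Prop :=
  exists2 Y, is_cond_prob P X G Y & {ae P, forall w, c <= Y w}.

End Probability.

(* Main.v *)
(* Along an accepted full-precision step (B + nu) p = - g the decrease is at
   least eta (p B p / 2 + nu |p|^2).  As the bound on nu / (lambda1 + nu) bounds
   nu itself, this dominates a fixed multiple of |g|^2, hence, by the
   Polyak-Lojasiewicz inequality, of f - f*.  So f - f* contracts by a factor
   that does not depend on the sample path; starting from its maximum over the
   compact set Omega, all paths are in the ball of radius delta from one common
   index on.  There, with e = x_k - x*,
     (e + p) (B + nu) = (e H - g) - e (H - B) + nu e,
   and B + nu >= lambda1 + nu gives |x_{k+1} - x*| <= b(chi) |e| with
   b(chi) = nu* + (chi + L delta) / lambda1, where chi = chi_H on the good event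
   and chi = 2 lambdan always.  The conditional probability of the bad event is
   at most p_H and |e| is a function of x_k, so
   E |x_{k+1} - x*| <= (b(chi_H) + p_H b(2 lambdan)) E |x_k - x*|. *)

Require Import Defs.
From HB Require Import structures.
From mathcomp Require Import all_boot all_order all_algebra.
From mathcomp Require Import all_classical all_reals all_analysis.
From mathcomp Require Import measurable_realfun ring lra.

Set Implicit Arguments.
Unset Strict Implicit.
Unset Printing Implicit Defensive.

Import Order.TTheory GRing.Theory Num.Theory.
Import numFieldNormedType.Exports.

Local Open Scope classical_set_scope.
Local Open Scope ring_scope.

(** * Euclidean norm, operator norm and Loewner bounds *)

Section EuclideanGeometry.
Context {R : realType} {n : nat}.
Implicit Types (u v w x : 'rV[R]_n) (A B : 'M[R]_n) (c : R).

Lemma dotvE u v : dotv u v = \sum_(i < n) u 0 i * v 0 i.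
Proof. by rewrite /dotv mxE; apply: eq_bigr => i _; rewrite mxE. Qed.

Lemma dotvC u v : dotv u v = dotv v u.
Proof. by rewrite !dotvE; apply: eq_bigr => i _; rewrite mulrC. Qed.

Lemma dotvDl u v w : dotv (u + v) w = dotv u w + dotv v w.
Proof. by rewrite /dotv mulmxDl mxE. Qed.

Lemma dotvZl c u v : dotv (c *: u) v = c * dotv u v.
Proof. by rewrite /dotv -scalemxAl mxE. Qed.

Lemma dotvNl u v : dotv (- u) v = - dotv u v.
Proof. by rewrite -scaleN1r dotvZl mulN1r. Qed.

Lemma dotvDr u v w : dotv u (v + w) = dotv u v + dotv u w.
Proof. by rewrite !(dotvC u) dotvDl. Qed.

Lemma dotvZr c u v : dotv u (c *: v) = c * dotv u v.
Proof. by rewrite !(dotvC u) dotvZl. Qed.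

Lemma dotvNr u v : dotv u (- v) = - dotv u v.
Proof. by rewrite !(dotvC u) dotvNl. Qed.

Lemma dotv0r u : dotv u 0 = 0.
Proof. by rewrite -[0 in LHS](scale0r u) dotvZr mul0r. Qed.

Definition dotv_bilinear :=
  (dotvDl, dotvDr, dotvZl, dotvZr, dotvNl, dotvNr).

Lemma dotv_mulmx u A v : dotv (u *m A) v = dotv u (v *m A^T).
Proof. by rewrite /dotv trmx_mul trmxK mulmxA. Qed.

Lemma enorm_ge0 u : 0 <= enorm u.
Proof. exact: sqrtr_ge0. Qed.

Lemma dotvv u : dotv u u = enorm u ^+ 2.
Proof.
rewrite /enorm sqr_sqrtr ?dotvE; last by rewrite sumr_ge0// => i _; exact: sqr_ge0.
by apply: eq_bigr => i _; rewrite expr2.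
Qed.

Lemma enorm_def u : enorm u = Num.sqrt (dotv u u).
Proof. by rewrite dotvv sqrtr_sqr ger0_norm ?enorm_ge0. Qed.

Lemma enormZ c u : enorm (c *: u) = `|c| * enorm u.
Proof.
rewrite !enorm_def dotvZl dotvZr mulrA -expr2 sqrtrM ?sqr_ge0//.
by rewrite sqrtr_sqr.
Qed.

Lemma enormN u : enorm (- u) = enorm u.
Proof. by rewrite -scaleN1r enormZ normrN1 mul1r. Qed.

Lemma enorm0 : enorm (0 : 'rV[R]_n) = 0.
Proof. by rewrite enorm_def dotv0r sqrtr0. Qed.

Lemma coord_le_enorm u i : `|u 0 i| <= enorm u.
Proof.
rewrite -sqrtr_sqr /enorm ler_wsqrtr// (bigD1 i)//= lerDl.
by rewrite sumr_ge0// => j _; exact: sqr_ge0.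
Qed.

Lemma enorm_eq0 u : enorm u = 0 -> u = 0.
Proof.
move=> u0; apply/rowP => i; rewrite mxE; apply/eqP; rewrite -normr_le0 -u0.
exact: coord_le_enorm.
Qed.

Lemma cauchy_schwarz u v : dotv u v <= enorm u * enorm v.
Proof.
have [/eqP u0|u0] := boolP (enorm u == 0).
  by rewrite u0 mul0r (enorm_eq0 u0) dotvC dotv0r.
have [/eqP v0|v0] := boolP (enorm v == 0).
  by rewrite v0 mulr0 (enorm_eq0 v0) dotv0r.
have up : 0 < enorm u by rewrite lt_neqAle eq_sym u0 enorm_ge0.
have vp : 0 < enorm v by rewrite lt_neqAle eq_sym v0 enorm_ge0.
(* The square expands to twice [enorm u * enorm v] times the difference of the two sides of the
   claim. *)
have := sqr_ge0 (enorm (enorm v *: u - enorm u *: v)).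
rewrite -dotvv !dotv_bilinear (dotvC v u) !dotvv => H.
have {}H : 0 <= 2 * (enorm u * enorm v) * (enorm u * enorm v - dotv u v) by nra.
by rewrite -subr_ge0 -(pmulr_rge0 _ (_ : 0 < 2 * (enorm u * enorm v)))// !mulr_gt0.
Qed.

Lemma enormD u v : enorm (u + v) <= enorm u + enorm v.
Proof.
rewrite -(@ler_pXn2r _ 2)// ?nnegrE ?enorm_ge0 ?addr_ge0 ?enorm_ge0//.
rewrite -dotvv !dotv_bilinear (dotvC v u) !dotvv.
have := cauchy_schwarz u v; nra.
Qed.

Lemma enorm_sqr_le c u : enorm u ^+ 2 <= c * enorm u -> 0 <= c -> enorm u <= c.
Proof.
move=> H c0; have := enorm_ge0 u; rewrite le_eqVlt => /predU1P[<-//|u0].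
by move: H; rewrite expr2 ler_pM2r.
Qed.

(** Boundedness makes the [sup] in [opnorm] a genuine supremum rather than a default value. Since
    the coordinates of v are at most 1 in absolute value, the absolute column sums of A bound the
    coordinates of [v *m A]. *)
Lemma opnorm_has_ubound A :
  has_ubound [set enorm (v *m A) | v in [set v : 'rV[R]_n | enorm v <= 1]].
Proof.
exists (Num.sqrt (\sum_(j < n) (\sum_(i < n) `|A i j|) ^+ 2)) => _ [v /= v1 <-].
rewrite /enorm ler_wsqrtr// ler_sum// => j _; rewrite -real_normK ?num_real//.
rewrite lerXn2r ?nnegrE ?sumr_ge0// mxE (le_trans (ler_norm_sum _ _ _))//.
apply: ler_sum => i _; rewrite normrM ler_piMl//.
exact: le_trans (coord_le_enorm v i) v1.
Qed.

Lemma enorm_mulmx_le_opnorm v A : enorm v <= 1 -> enorm (v *m A) <= opnorm A.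
Proof.
by move=> v1; have := ub_le_sup (opnorm_has_ubound A); apply; exists v.
Qed.

Lemma enorm_mulmx_le v A : enorm (v *m A) <= opnorm A * enorm v.
Proof.
have := enorm_ge0 v; rewrite le_eqVlt => /predU1P[v0|v0].
  by rewrite -v0 (enorm_eq0 (esym v0)) mul0mx enorm0 mulr0.
rewrite -ler_pdivrMr// mulrC -[X in X * _]ger0_norm; last by rewrite invr_ge0 ltW.
rewrite -enormZ scalemxAl; apply: enorm_mulmx_le_opnorm; rewrite enormZ.
by rewrite ger0_norm ?mulVf ?gt_eqF// invr_ge0 ltW.
Qed.

Lemma loewner_ge_dotv c A v :
  loewner_le c%:M A -> c * enorm v ^+ 2 <= dotv (v *m A) v.
Proof.
move=> [_ /(_ v)]; rewrite mulmxBr mul_mx_scalar -dotvv !dotv_bilinear; lra.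
Qed.

Lemma loewner_le_dotv c A v :
  loewner_le A c%:M -> dotv (v *m A) v <= c * enorm v ^+ 2.
Proof.
move=> [_ /(_ v)]; rewrite mulmxBr mul_mx_scalar -dotvv !dotv_bilinear; lra.
Qed.

Lemma loewner_sym c A : loewner_le c%:M A -> A^T = A.
Proof.
move=> [+ _]; rewrite linearB/= tr_scalar_mx => /(congr1 (+%R c%:M)).
by rewrite addrCA subrr addr0 addrCA subrr addr0.
Qed.

(* Nonnegativity of the form [A] at [c *: v - v *m A], i.e. [A ^+ 2 <= c A]. *)
Lemma loewner_sqr_le (l c : R) A v : 0 <= l -> 0 < c ->
  loewner_le l%:M A -> loewner_le A c%:M ->
  enorm (v *m A) ^+ 2 <= c * dotv (v *m A) v.
Proof.
move=> l0 c0 lA Ac; have sA := loewner_sym lA.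
have H1 := loewner_ge_dotv (c *: v - v *m A) lA.
have H2 := loewner_le_dotv (v *m A) Ac.
have H3 : 0 <= l * enorm (c *: v - v *m A) ^+ 2 by rewrite mulr_ge0 ?sqr_ge0.
move: (le_trans H3 H1).
rewrite mulmxBl -scalemxAl !dotv_bilinear.
rewrite [dotv (v *m A *m A) v]dotv_mulmx sA -!dotvv in H2 *.
move: H2; set x := dotv (v *m A) (v *m A); set y := dotv (v *m A) v => H2 H.
have {}H : 0 <= c * (c * y - x) by nra.
by rewrite -subr_ge0 -(pmulr_rge0 _ c0).
Qed.

Lemma loewner_enorm_le (l c : R) A v : 0 <= l -> 0 < c ->
  loewner_le l%:M A -> loewner_le A c%:M -> enorm (v *m A) <= c * enorm v.
Proof.
move=> l0 c0 lA Ac; have H1 := loewner_sqr_le v l0 c0 lA Ac.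
have H2 := loewner_le_dotv v Ac.
rewrite -(@ler_pXn2r _ 2)// ?nnegrE ?mulr_ge0 ?enorm_ge0 ?(ltW c0)//.
by rewrite (le_trans H1)// exprMn [c ^+ 2]expr2 -mulrA ler_pM2l.
Qed.

(** Cauchy-Schwarz for [v *m (A + c%:M)] against v, followed by division by [enorm v]. This takes
    the place of a bound on the inverse of the regularized Hessian. *)
Lemma loewner_enorm_ge (l c : R) A v : 0 < l -> 0 <= c ->
  loewner_le l%:M A -> (l + c) * enorm v <= enorm (v *m (A + c%:M)).
Proof.
move=> l0 c0 lA; have H1 := loewner_ge_dotv v lA.
have H2 := cauchy_schwarz (v *m (A + c%:M)) v.
have {}H2 : (l + c) * enorm v ^+ 2 <= enorm (v *m (A + c%:M)) * enorm v.
  apply: le_trans H2; rewrite mulmxDr mul_mx_scalar !dotv_bilinear dotvv; lra.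
have := enorm_ge0 v; rewrite le_eqVlt => /predU1P[<-|v0].
  by rewrite mulr0 enorm_ge0.
by move: H2; rewrite expr2 mulrA ler_pM2r.
Qed.

End EuclideanGeometry.

(** * Derivatives along lines, strong convexity and Taylor estimates *)

Section SmoothFunctions.
Context {R : realType} {n : nat}.
Implicit Types (u v x y : 'rV[R]_n) (f : 'rV[R]_n -> R) (t c l : R).

Lemma is_derive_line (W : normedModType R) (F : 'rV[R]_n -> W) x v t :
  differentiable F (x + t *: v) ->
  is_derive t 1 (fun s => F (x + s *: v)) ('D_v F (x + t *: v)).
Proof.
move=> /(@diff_derivable _ _ _ _ _ v) dF.
(* The difference quotient in the line parameter and the one of the directional derivative are the
   same function of h, so both derivability and the value carry over. *)
have E : (fun h : R => h^-1 *: (((fun s => F (x + s *: v)) \o shift t) (h *: 1)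
                               - F (x + t *: v))) =
         (fun h => h^-1 *: ((F \o shift (x + t *: v)) (h *: v) - F (x + t *: v))).
  apply/funext => h /=; congr (_ *: (F _ - _)).
  by rewrite [h *: 1]mulr1 scalerDl addrCA.
by split; rewrite /derivable /derive E.
Qed.

Lemma is_derive_dotv (G : R -> 'rV[R]_n) (dG : 'rV[R]_n) u t :
  is_derive t 1 G dG -> is_derive t 1 (fun s => dotv (G s) u) (dotv dG u).
Proof.
move=> [dvG <-].
have -> : (fun s => dotv (G s) u) = \sum_(i < n) (fun s => u 0 i *: G s 0 i).
  apply/funext => s; rewrite dotvE fct_sumE; apply: eq_bigr => i _.
  by rewrite mulrC.
have -> : dotv ('D_1 G t) u = \sum_(i < n) u 0 i *: 'D_1 (fun s => G s 0 i) t.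
  by rewrite dotvE derive_mx//; apply: eq_bigr => i _; rewrite mxE mulrC.
apply: is_derive_sum => i; apply: is_deriveZ; apply: derivableP.
by move/derivable_mxP : dvG; exact.
Qed.

Lemma derive_grad f x v : differentiable f x -> 'D_v f x = dotv (grad f x) v.
Proof.
move=> df; rewrite deriveE// {1}(row_sum_delta v) linear_sum dotvE.
by apply: eq_bigr => i _; rewrite linearZ /= mxE deriveE// mulrC.
Qed.

Lemma derive_hess f x v :
  differentiable (grad f) x -> 'D_v (grad f) x = v *m hess f x.
Proof. exact: deriveEjacobian. Qed.

(** Including [s = 0] lets the intermediate point of one application, which may be 0, be the
    endpoint of the next. *)
Lemma MVT_line (g dg : R -> R) : (forall t, is_derive t 1 g (dg t)) ->
  forall s, 0 <= s -> exists2 t, 0 <= t <= s & g s - g 0 = dg t * s.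
Proof.
move=> dgE s s0.
have gc : {within `[0, s], continuous g}.
  apply: continuous_subspaceT => t; apply: differentiable_continuous.
  by apply/derivable1_diffP; have [] := dgE t.
have [t ts E] := MVT_segment s0 (fun t _ => dgE t) gc.
by exists t; [rewrite in_itv in ts|rewrite E subr0].
Qed.

Lemma is_derive_line_grad f x v t : (forall z, differentiable f z) ->
  is_derive t 1 (fun s => f (x + s *: v)) (dotv (grad f (x + t *: v)) v).
Proof.
by move=> df; rewrite -derive_grad//; exact: is_derive_line.
Qed.

Lemma is_derive_line_dotv_grad f x v u t :
  (forall z, differentiable (grad f) z) ->
  is_derive t 1 (fun s => dotv (grad f (x + s *: v)) u)
    (dotv (v *m hess f (x + t *: v)) u).
Proof.
move=> dg.
have := @is_derive_line _ (grad f) x v t (dg _).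
rewrite derive_hess; last exact: dg.
exact: is_derive_dotv.
Qed.

Lemma is_derive_add_quadratic (g : R -> R) dg a b t : is_derive t 1 g dg ->
  is_derive t 1 (fun s => g s - a * s - b * s ^+ 2) (dg - a - 2 * b * t).
Proof.
move=> H.
have H1 := @is_deriveZ _ _ _ id (- a) t 1 _ (is_derive_id _ _).
have H2 := @is_deriveZ _ _ _ _ (- b) t 1 _ (@is_deriveX _ _ id 2 t 1 _ (is_derive_id _ _)).
have := is_deriveD (is_deriveD H H1) H2.
congr (is_derive _ _ _ _).
  apply/funext => s /=.
  change (g s + (- a) * s + (- b) * (s * s) = g s - a * s - b * s ^+ 2); ring.
change (dg + (- a) * 1 + (- b) * (2%:R * t ^+ 1 * 1) = dg - a - 2 * b * t); ring.
Qed.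

Definition twice_differentiable f : Prop :=
  (forall x, differentiable f x) /\ (forall x, differentiable (grad f) x).

(** The mean value theorem is used twice: on f along the segment minus the linear and quadratic
    terms, then on the slope between 0 and the point t just found. The slope grows by at least
    [l * enorm v ^+ 2 * t], which is exactly the derivative of the quadratic term. *)
Lemma strong_convexity f l x v : twice_differentiable f ->
  (forall z, loewner_le l%:M (hess f z)) ->
  f x + dotv (grad f x) v + 2^-1 * l * enorm v ^+ 2 <= f (x + v).
Proof.
move=> [df dg] lf; pose q := enorm v ^+ 2; pose d := dotv (grad f x) v.
have [t /andP[t0 _]] := MVT_line (fun t =>
  is_derive_add_quadratic d (2^-1 * l * q) (is_derive_line_grad x v t df)) ler01.
rewrite !scale1r !scale0r expr1n expr0n/= addr0 !mulr0 !mulr1 !subr0 => E.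
have [s _] := MVT_line (fun s => is_derive_line_dotv_grad x v v s dg) t0.
rewrite scale0r addr0 -/d => E2.
have H := ler_wpM2r t0 (loewner_ge_dotv v (lf (x + s *: v))).
rewrite -/q; rewrite -{}E2 -/q in H.
set D := dotv (grad _ (_ + _)) v in E H; lra.
Qed.

(* Strong convexity between [x] and [y], minimized over [y] by completing the
   square. *)
Lemma polyak_lojasiewicz f l x y : 0 < l -> twice_differentiable f ->
  (forall z, loewner_le l%:M (hess f z)) ->
  2 * l * (f x - f y) <= enorm (grad f x) ^+ 2.
Proof.
move=> l0 fD lf; have := strong_convexity x (y - x) fD lf.
set v := y - x; have -> : x + v = y by rewrite addrC subrK.
move=> /(ler_wpM2l (mulr_ge0 (ler0n _ 2) (ltW l0))) H.
have := sqr_ge0 (enorm (grad f x + l *: v)).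
rewrite -[X in 0 <= X]dotvv dotvDl !dotvDr !dotvZl !dotvZr (dotvC v) !dotvv.
by move: H; set g := dotv _ _; lra.
Qed.

(** Fermat's rule on the line in the direction of the gradient itself, where the derivative at 0 is
    the squared gradient norm. *)
Lemma grad_minimizer f x : (forall z, differentiable f z) ->
  (forall y, f x <= f y) -> grad f x = 0.
Proof.
move=> df fmin; apply: enorm_eq0; apply/eqP.
rewrite -sqrf_eq0 -dotvv; apply/eqP.
pose g t := f (x + t *: grad f x).
have gE t : is_derive t 1 g (dotv (grad f (x + t *: grad f x)) (grad f x)).
  exact: is_derive_line_grad.
have dg t : derivable g t 1 by have [] := gE t.
have N11 : -1 <= 1 :> R by lra.
have : is_derive (0 : R) 1 g 0.
  apply: (@derive1_at_min _ g (-1) 1) => //.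
  - by rewrite in_itv/= ltrN10 ltr01.
  - by move=> t _; rewrite /g scale0r addr0.
move/@derive_val; have := gE 0; move/@derive_val => ->.
by rewrite scale0r addr0.
Qed.

Lemma quadratic_growth f l x y : twice_differentiable f ->
  (forall z, loewner_le l%:M (hess f z)) -> (forall z, f x <= f z) ->
  2^-1 * l * enorm (y - x) ^+ 2 <= f y - f x.
Proof.
move=> fD lf fmin; have := strong_convexity x (y - x) fD lf.
rewrite grad_minimizer//; last by case: fD.
by rewrite dotvC dotv0r addr0 [x + _]addrC subrK lerBrDl.
Qed.

(** The mean value theorem is scalar, so the gradient is paired with the error u itself: this gives
    the squared norm of u as the pairing of [e *m (hess f x - hess f y)] with u for one y on the
    segment, and one factor [enorm u] cancels. The absolute value on L covers either sign of the
    Lipschitz constant. *)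
Lemma grad_taylor_le f z delta L x : (forall y, differentiable (grad f) y) ->
  grad f z = 0 -> hess_lipschitz_on_ball f z delta L -> enorm (x - z) <= delta ->
  enorm ((x - z) *m hess f x - grad f x) <= `|L| * enorm (x - z) ^+ 2.
Proof.
move=> dg gc0 lip xd; set e := x - z; set u := _ - _.
have [t t01] := MVT_line (fun t => is_derive_line_dotv_grad z e u t dg) ler01.
rewrite scale1r scale0r addr0 gc0 (dotvC 0) dotv0r subr0 mulr1.
rewrite {1}/e addrC subrK; set y := z + t *: e => E.
have /andP[t0 t1] := t01.
have yd : enorm (y - z) <= delta.
  rewrite /y addrC addKr enormZ ger0_norm// (le_trans _ xd)//.
  by rewrite ler_piMl ?enorm_ge0.
have xy : x - y = (1 - t) *: e.
  by rewrite /y scalerBl scale1r opprD addrA.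
have xyle : L * enorm (x - y) <= `|L| * enorm e.
  rewrite xy enormZ ger0_norm ?subr_ge0//.
  apply: (@le_trans _ _ (`|L| * ((1 - t) * enorm e))).
    by rewrite ler_wpM2r ?ler_norm// mulr_ge0 ?enorm_ge0 ?subr_ge0.
  by rewrite ler_wpM2l// ler_piMl ?enorm_ge0// gerBl.
have lipxy := le_trans (lip x y xd yd) xyle.
apply: enorm_sqr_le; last by rewrite mulr_ge0 ?sqr_ge0.
rewrite -dotvv {1}/u dotvDl dotvNl E -dotvNl -dotvDl -mulmxBr.
apply: le_trans (cauchy_schwarz _ _) _.
rewrite ler_wpM2r ?enorm_ge0//; apply: le_trans (enorm_mulmx_le _ _) _.
by rewrite expr2 mulrA ler_wpM2r ?enorm_ge0.
Qed.

End SmoothFunctions.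

(** * Gradients, Hessians and spectra of subsampled averages *)

Section Averages.
Context {R : realType} {N n : nat}.
Implicit Types (phi : 'I_N -> 'rV[R]_n -> R) (S : {set 'I_N}) (x v : 'rV[R]_n).

(** Zero weights off S turn an average over a nonempty S into a convex combination over all
    indices. *)
Definition avg_weight S (i : 'I_N) : R := #|S|%:R^-1 * (i \in S)%:R.

Lemma avg_weight_ge0 S i : 0 <= avg_weight S i.
Proof. by rewrite mulr_ge0// invr_ge0. Qed.

Lemma sum_avg_weight S : (0 < #|S|)%N -> \sum_i avg_weight S i = 1.
Proof.
move=> S0; have cS : (\sum_i (i \in S))%N = #|S|.
  by rewrite -sum1_card [RHS]big_mkcond; apply: eq_bigr => i _; case: (i \in S).
by rewrite -mulr_sumr -natr_sum cS mulVf// pnatr_eq0 -lt0n.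
Qed.

Lemma favgE phi S : favg phi S = \sum_i (fun x => avg_weight S i *: phi i x).
Proof.
apply/funext => x; rewrite fct_sumE /favg big_mkcond/= mulr_sumr.
apply: eq_bigr => i _; rewrite /avg_weight.
by case: (i \in S); rewrite ?mulr1 ?mulr0 ?scale0r.
Qed.

Section Derivatives.
Variables (phi : 'I_N -> 'rV[R]_n -> R) (S : {set 'I_N}).
Hypothesis phiD : forall i, twice_differentiable (phi i).

Lemma grad_favg :
  grad (favg phi S) = \sum_i (fun x => avg_weight S i *: grad (phi i) x).
Proof.
apply/funext => x; rewrite fct_sumE; apply/rowP => j.
rewrite mxE favgE derive_sum => [|i].
  rewrite summxE; apply: eq_bigr => i _; rewrite deriveZ ?mxE//.
  by apply: diff_derivable; case: (phiD i).
by apply: derivableZ; apply: diff_derivable; case: (phiD i).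
Qed.

Lemma twice_differentiable_favg : twice_differentiable (favg phi S).
Proof.
split=> x; rewrite ?grad_favg ?favgE; apply: differentiable_sum => i;
  by apply: differentiableZ; case: (phiD i).
Qed.

Lemma hess_favg x : hess (favg phi S) x = \sum_i avg_weight S i *: hess (phi i) x.
Proof.
have dphi i : derivable (grad (phi i)) x =1 fun=> True.
  by move=> v; apply/propext; split=> // _; apply: diff_derivable; case: (phiD i).
(* Row j of the Jacobian is the derivative of the gradient along the j-th basis vector, which
   reduces the claim to linearity of directional derivatives. *)
apply/row_matrixP => j; rewrite !rowE mulmx_sumr -derive_hess; last first.
  by case: twice_differentiable_favg.
rewrite grad_favg derive_sum => [|i]; last by apply: derivableZ; rewrite dphi.
apply: eq_bigr => i _; rewrite deriveZ ?dphi// derive_hess ?scalemxAr//.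
by case: (phiD i).
Qed.

End Derivatives.

Lemma loewner_ge_avg (H : 'I_N -> 'M[R]_n) S (l : R) : (0 < #|S|)%N ->
  (forall i, loewner_le l%:M (H i)) ->
  loewner_le l%:M (\sum_i avg_weight S i *: H i).
Proof.
move=> S0 lH; rewrite /loewner_le.
have -> : \sum_i avg_weight S i *: H i - l%:M =
          \sum_i avg_weight S i *: (H i - l%:M).
  under [RHS]eq_bigr do rewrite scalerBr.
  by rewrite sumrB -scaler_suml sum_avg_weight// scale1r.
split=> [|v].
  rewrite linear_sum; apply: eq_bigr => i _; rewrite linearZ/=.
  by case: (lH i) => ->.
rewrite mulmx_sumr /dotv mulmx_suml summxE sumr_ge0// => i _.
rewrite -scalemxAr -scalemxAl mxE mulr_ge0 ?avg_weight_ge0//.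
by case: (lH i) => _; exact.
Qed.

Lemma loewner_leN (A B : 'M[R]_n) : loewner_le A B = loewner_le (- B) (- A).
Proof. by rewrite /loewner_le opprK addrC. Qed.

Lemma loewner_le_avg (H : 'I_N -> 'M[R]_n) S (c : R) : (0 < #|S|)%N ->
  (forall i, loewner_le (H i) c%:M) ->
  loewner_le (\sum_i avg_weight S i *: H i) c%:M.
Proof.
move=> S0 Hc; rewrite loewner_leN -sumrN -raddfN/=.
under eq_bigr do rewrite -scalerN.
by apply: loewner_ge_avg => // i; rewrite raddfN/= -loewner_leN.
Qed.

Lemma hess_favg_spectrum phi S (l c : R) x : (0 < #|S|)%N ->
  (forall i, twice_differentiable (phi i)) ->
  (forall i y, loewner_le l%:M (hess (phi i) y) /\
               loewner_le (hess (phi i) y) c%:M) ->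
  loewner_le l%:M (hess (favg phi S) x) /\ loewner_le (hess (favg phi S) x) c%:M.
Proof.
move=> S0 phiD lc; rewrite hess_favg//; split.
  by apply: loewner_ge_avg => // i; case: (lc i x).
by apply: loewner_le_avg => // i; case: (lc i x).
Qed.

End Averages.

(** * Decrease and contraction of one regularized Newton step *)

Section RegularizedStep.
Context {R : realType} {n : nat}.
Implicit Types (g p e : 'rV[R]_n) (B H : 'M[R]_n) (l c nu : R).

(** With a = pBp and b = |p|^2, the model decrease is a/2 + nu b, while |g|^2 = |pB + nu p|^2 is at
    most 2|pB|^2 + 2 nu^2 b, hence at most 2 c a + 2 nubar nu b. The factor 4c + 2 nubar covers both
    terms. *)
Lemma regularized_step_decrease l c nu nubar B g p : 0 < l -> 0 < c ->
  0 <= nu <= nubar -> loewner_le l%:M B -> loewner_le B c%:M ->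
  p *m (B + nu%:M) = - g ->
  enorm g ^+ 2 <= (4 * c + 2 * nubar) * (- dotv g p - 2^-1 * dotv (p *m B) p).
Proof.
move=> l0 c0 /andP[nu0 nunu] lB Bc pE.
have gE : - g = p *m B + nu *: p by rewrite -pE mulmxDr mul_mx_scalar.
have H1 := loewner_sqr_le p (ltW l0) c0 lB Bc.
have H2 := loewner_ge_dotv p lB.
have H3 : enorm g ^+ 2 <= 2 * enorm (p *m B) ^+ 2 + 2 * (nu ^+ 2 * enorm p ^+ 2).
  have := sqr_ge0 (enorm (p *m B - nu *: p)).
  rewrite -[enorm g]enormN gE -!dotvv !dotv_bilinear; lra.
have -> : - dotv g p = dotv (p *m B) p + nu * enorm p ^+ 2.
  by rewrite -dotvNl gE dotvDl dotvZl dotvv.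
move: H1 H2 H3; set a := dotv _ _; set b := enorm p ^+ 2 => H1 H2 H3.
have b0 : 0 <= b := sqr_ge0 _.
have a0 : 0 <= a by rewrite (le_trans _ H2)// mulr_ge0// ltW.
have nb0 : 0 <= nubar := le_trans nu0 nunu.
have H4 : 2 * (nu ^+ 2 * b) <= 2 * nubar * (nu * b).
  by rewrite -mulrA ler_pM2l// expr2 -mulrA ler_wpM2r// mulr_ge0.
have H5 : 0 <= c * (nu * b) := mulr_ge0 (ltW c0) (mulr_ge0 nu0 b0).
have H6 : 0 <= nubar * a := mulr_ge0 nb0 a0.
lra.
Qed.

Lemma regularized_step_contraction l nu nustar B H g e p L delta chi : 0 < l ->
  0 <= nu -> nu / (l + nu) <= nustar -> loewner_le l%:M B ->
  p *m (B + nu%:M) = - g -> enorm (e *m H - g) <= L * enorm e ^+ 2 -> 0 <= L ->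
  enorm e <= delta -> enorm (e *m (H - B)) <= chi * enorm e -> 0 <= chi ->
  enorm (e + p) <= (nustar + (chi + L * delta) / l) * enorm e.
Proof.
move=> l0 nu0 nus lB pE HL L0 ed Hchi chi0.
have lnu : 0 < l + nu by rewrite ltr_wpDr.
have e0 := enorm_ge0 e.
have E : (e + p) *m (B + nu%:M) = (e *m H - g) - e *m (H - B) + nu *: e.
  rewrite mulmxDl pE mulmxDr mulmxBr mul_mx_scalar opprB.
  move: (e *m B) (e *m H) (nu *: e) => X Y Z.
  by apply/rowP => j; rewrite !mxE; ring.
have H1 : (l + nu) * enorm (e + p) <= (L * delta + chi + nu) * enorm e.
  apply: (le_trans (loewner_enorm_ge _ l0 nu0 lB)); rewrite E.
  apply: (le_trans (enormD _ _)); rewrite mulrDl lerD//; last first.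
    by rewrite enormZ ger0_norm.
  apply: (le_trans (enormD _ _)); rewrite mulrDl enormN lerD//.
  by rewrite (le_trans HL)// expr2 mulrA ler_wpM2r// ler_wpM2l.
have H2 : enorm (e + p) <= (L * delta + chi + nu) / (l + nu) * enorm e.
  by rewrite mulrAC ler_pdivlMr// mulrC.
apply: (le_trans H2); rewrite ler_wpM2r//.
(* The quotient is split: nu / (l + nu) is bounded by [nustar], and in the remaining term the
   denominator is lowered to l. *)
rewrite mulrDl addrC lerD// [chi + _]addrC ler_wpM2l//.
  by rewrite addr_ge0// mulr_ge0// (le_trans e0).
by rewrite lef_pV2 ?posrE// lerDl.
Qed.

End RegularizedStep.

(** * From a conditional probability bound to a bound on expectations *)

Section ConditionalProbability.
Context {R : realType} {n : nat} {d : measure_display} {T : measurableType d}.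
Implicit Types (X : T -> 'rV[R]_n) (P : probability T R) (E G : set T).

(** The space is left generic so that the lemma also applies to the sigma-algebra generated by X. *)
Lemma measurable_enorm d' (T' : measurableType d') (X : T' -> 'rV[R]_n) (z : 'rV[R]_n) :
  (forall i, measurable_fun setT (fun w => X w 0 i)) ->
  measurable_fun setT (fun w => enorm (X w - z)).
Proof.
move=> mX; apply: (measurableT_comp (continuous_measurable_fun (@sqrt_continuous R))).
apply: measurable_sum => i.
apply: (measurableT_comp (@exprn_measurable R setT 2)).
have -> : (fun w => (X w - z) 0 i) = (fun w => X w 0 i + (- z 0 i)).
  by apply/funext => w; rewrite !mxE.
by apply: measurable_funD => //; exact: measurable_cst.
Qed.

Lemma sigma_generated_measurable X E :
  random_vector X -> sigma_generated X E -> measurable E.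
Proof.
move=> mX; apply: smallest_sub; first exact: sigma_algebra_measurable.
by move=> _ [i [B mB ->]]; rewrite -[_ @^-1` _]setTI; exact: mX.
Qed.

Lemma sigma_generated_enorm X z (B : set R) : measurable B ->
  sigma_generated X ((fun w => enorm (X w - z)) @^-1` B).
Proof.
move=> mB.
pose C := [set E | exists i, exists2 B : set R, measurable B
                       & E = (fun w => X w 0 i) @^-1` B].
(* T is re-equipped with the sigma-algebra generated by the coordinates of X; measurability of the
   distance there is membership in [sigma_generated X]. *)
have mX i : measurable_fun [set: g_sigma_algebraType C]
    (fun w : g_sigma_algebraType C => X w 0 i).
  by move=> _ D mD; rewrite setTI; apply: sub_gen_smallest; exists i, D.
by have := measurable_enorm z mX measurableT mB; rewrite setTI.
Qed.

Lemma integral_ge_cst_mul P E (Y : T -> R) (c : R) : measurable E -> 0 <= c ->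
  P.-integrable setT (EFin \o Y) -> {ae P, forall w, c <= Y w} ->
  (c%:E * P E <= \int[P]_(w in E) (Y w)%:E)%E.
Proof.
move=> mE c0 iY cY.
have mY : measurable_fun E (EFin \o Y).
  by apply: measurable_funTS; exact: measurable_int iY.
have mc : measurable_fun E (cst c%:E : T -> \bar R) by exact: measurable_cst.
(* The bound on Y holds only almost everywhere. The maximum of c and Y agrees with Y almost
   everywhere and is bounded below at every point. *)
have mM : measurable_fun E (fun w => maxe (cst c%:E w) ((EFin \o Y) w)).
  exact: measurable_maxe.
rewrite -integral_cst// (@ae_eq_integral _ _ _ _ _
  (fun w => maxe (cst c%:E w) ((EFin \o Y) w)) (fun w => (Y w)%:E))//.
  apply: ge0_le_integral => // w _.
  by rewrite le_max lexx.
case: cY => A [mA PA cA]; exists A; split=> // w /= H.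
by apply: cA => /= cw; apply: H => _; apply/esym/max_idPr; rewrite lee_fin.
Qed.

(** Integrating the version Y over E gives P(G and E) at least (1 - c) P(E); the rest of P(E)
    belongs to the complement of G. *)
Lemma cond_prob_ge_setC P X G (c : R) E : 0 <= c -> random_vector X ->
  cond_prob_ge P X G (1 - c) -> c <= 1 -> sigma_generated X E ->
  (P (E `&` ~` G) <= c%:E * P E)%E.
Proof.
move=> c0 mX [Y [mG _ iY EY] cY] c1 sE.
have mE := sigma_generated_measurable mX sE.
have c10 : 0 <= 1 - c by rewrite subr_ge0.
have := integral_ge_cst_mul mE c10 iY cY.
rewrite EY// => H.
have DI : (P E = P (E `&` ~` G) + P (G `&` E))%E.
  by rewrite (setIC G) -setDE; exact: measureDI.
have fE : P E \is a fin_num by exact: fin_num_measure.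
have fG : P (G `&` E) \is a fin_num by apply: fin_num_measure; exact: measurableI.
have fC : P (E `&` ~` G) \is a fin_num.
  by apply: fin_num_measure => //; apply: measurableI => //; exact: measurableC.
move: H DI; rewrite -(fineK fE) -(fineK fG) -(fineK fC) -EFinD -!EFinM !lee_fin.
by move=> H [] DI; lra.
Qed.

(* Pushed forward to R by the distance to [z], both sides become integrals
   against measures that are compared on sigma(X)-events only. *)
Lemma ge0_le_integral_cond_setC P X G (c : R) z : 0 <= c <= 1 -> random_vector X ->
  cond_prob_ge P X G (1 - c) ->
  (\int[P]_(w in ~` G) (enorm (X w - z))%:E
     <= c%:E * \int[P]_w (enorm (X w - z))%:E)%E.
Proof.
move=> /andP[c0 c1] mX PG; have [_ [mG _ _ _] _] := PG.
have mGC : measurable (~` G) by exact: measurableC.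
pose f w := enorm (X w - z).
have mf : measurable_fun setT f := measurable_enorm z mX.
have mEf : measurable_fun setT (EFin \o f) by exact/measurable_EFinP.
have f0 w : (0 <= (f w)%:E)%E by rewrite lee_fin enorm_ge0.
(* Restricting the measure moves the bad event out of the domain of integration, so that both sides
   integrate over the whole space. *)
pose m1 := mrestr P mGC.
have -> : (\int[P]_(w in ~` G) (f w)%:E = \int[m1]_(w in ~` G) (f w)%:E)%E.
  by apply: eq_measure_integral => A mA AG; rewrite /= /m1 /mrestr setIidl.
apply: le_trans (_ : _ <= \int[m1]_w (f w)%:E)%E _.
  by apply: ge0_subset_integral => //.
(* The absolute value keeps the integrand nonnegative on all of R and changes nothing on the values
   of f. *)
pose g (y : R) : \bar R := `|y|%:E.
have mg : measurable_fun setT g.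
  by apply/measurable_EFinP; exact: normr_measurable.
have fg (m : {measure set T -> \bar R}) :
    (\int[m]_w (f w)%:E = \int[pushforward m f]_y g y)%E.
  rewrite (ge0_integral_pushforward mf)//; last by move=> y _; rewrite lee_fin.
  by apply: eq_integral => w _; rewrite /g /= ger0_norm ?enorm_ge0.
rewrite !fg.
(* With c absorbed into the measure, it remains to compare two measures on Borel sets B, whose
   preimages under f are sigma(X)-events. *)
rewrite -(@ge0_integral_mscale _ _ _ _ _ measurableT (NngNum c0))//; last first.
  by move=> y _; rewrite lee_fin.
apply: ge0_le_measure_integral => // [B mB|y]; last by rewrite lee_fin.
rewrite /m1 /mscale /pushforward /mrestr /=.
apply: (cond_prob_ge_setC c0 mX PG c1).
exact: sigma_generated_enorm.
Qed.

(** On G the bound b1 is used and the integral enlarged to the whole space; off G the cruder b2 is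
    paid only with weight c. *)
Lemma expectation_le_cond P X (e' : T -> R) G (c b1 b2 : R) z : 0 <= c <= 1 ->
  0 <= b1 -> 0 <= b2 ->
  random_vector X -> measurable_fun setT e' -> (forall w, 0 <= e' w) ->
  cond_prob_ge P X G (1 - c) ->
  (forall w, G w -> e' w <= b1 * enorm (X w - z)) ->
  (forall w, e' w <= b2 * enorm (X w - z)) ->
  ('E_P[e'] <= (b1 + b2 * c)%:E * 'E_P[fun w => enorm (X w - z)])%E.
Proof.
move=> c01 b10 b20 mX me' e'0 PG e'1 e'2; have [_ [mG _ _ _] _] := PG.
have mGC : measurable (~` G) by exact: measurableC.
pose f w := enorm (X w - z).
have mEf A : measurable_fun A (EFin \o f).
  by apply: measurable_funTS; apply/measurable_EFinP; exact: measurable_enorm.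
have mEe A : measurable_fun A (EFin \o e').
  by apply: measurable_funTS; exact/measurable_EFinP.
have f0 w : (0 <= (f w)%:E)%E by rewrite lee_fin enorm_ge0.
rewrite unlock.
have -> : (\int[P]_w (e' w)%:E =
           \int[P]_(w in G) (e' w)%:E + \int[P]_(w in ~` G) (e' w)%:E)%E.
  rewrite -ge0_integral_setU ?setUv//; last exact/disj_setPCl.
  by move=> w _; rewrite lee_fin.
have mul b A : 0 <= b -> measurable A -> (forall w, A w -> e' w <= b * f w) ->
    (\int[P]_(w in A) (e' w)%:E <= b%:E * \int[P]_(w in A) (f w)%:E)%E.
  move=> b0 mA H; rewrite -(ge0_integralZl P mA (mEf A) (fun w _ => f0 w))//.
  apply: ge0_le_integral => //.
  - by move=> w _; rewrite lee_fin.
  - by apply: measurable_funeM; exact: mEf.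
rewrite EFinD ge0_muleDl ?lee_fin ?mulr_ge0//; last by case/andP: c01.
apply: leeD.
  apply: le_trans (mul b1 G b10 mG e'1) _.
  rewrite lee_wpmul2l ?lee_fin//.
  by apply: ge0_subset_integral => //; exact: mEf.
apply: le_trans (mul b2 _ b20 mGC (fun w _ => e'2 w)) _.
rewrite EFinM -muleA lee_wpmul2l ?lee_fin//.
exact: ge0_le_integral_cond_setC.
Qed.

End ConditionalProbability.

(** * Geometric decay, bounds on compact sets and the size of the regularization *)

Lemma geometric_decay (R : realType) (q c : R) : 0 <= q < 1 -> 0 < c ->
  exists J : nat, forall j, (J <= j)%N -> q ^+ j <= c.
Proof.
move=> /andP[q0 q1] c0.
have : (fun j => q ^+ j) @ \oo --> (0 : R) by apply: cvg_expr; rewrite ger0_norm.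
move=> /cvgrPdist_le /(_ _ c0) [J _ HJ]; exists J => j Jj.
by have := HJ j Jj; rewrite sub0r normrN ger0_norm// exprn_ge0.
Qed.

Lemma compact_ubound (R : realType) (n : nat) (f : 'rV[R]_n -> R) (Omega : set 'rV[R]_n) :
  continuous f -> compact Omega -> exists M, forall x, Omega x -> f x <= M.
Proof.
move=> fc Oc; have [[y Oy]|O0] := pselect (Omega !=set0); last first.
  by exists 0 => x Ox; case: O0; exists x.
have [c _ fM] := @EVT_max_rV _ _ f Omega (ex_intro _ y Oy) Oc (continuous_subspaceT fc).
by exists (f c) => x Ox; apply: fM; rewrite inE.
Qed.

Lemma regularization_le (R : realType) (l nu nustar : R) :
  0 < l -> 0 <= nu -> nustar < 1 -> nu / (l + nu) <= nustar ->
  nu <= nustar * l / (1 - nustar).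
Proof.
move=> l0 nu0 ns1; have lnu : 0 < l + nu by rewrite ltr_wpDr.
by rewrite ler_pdivrMr// ler_pdivlMr ?subr_gt0//; lra.
Qed.

(** * Descent and uniform convergence of full-precision runs *)

Section Algorithm.
Context {R : realType} {N n : nat}.
Variables (phi : 'I_N -> 'rV[R]_n -> R) (h : nat -> R) (a : iretr_data R n).
Implicit Types (s : trace R N n) (l c nu nubar : R).

Lemma card_full_sample (A : {set 'I_N}) : #|A| = N -> A = [set: 'I_N]%SET.
Proof. by move=> AN; apply/eqP; rewrite eqEcard finset.subsetT cardsT card_ord AN /=. Qed.

(** With both samples full, the acceptance test compares the true decrease of f with the model
    decrease, whose constant terms cancel. *)
Lemma full_precision_pass s k (t := tr_T s k) :
  is_iretr_run phi h a s -> tr_N s k = N -> tr_Nnew s k t = N ->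
  [/\ tr_x s k.+1 = tr_x s k + tr_p s k t,
      tr_Inew s k t = [set: 'I_N]%SET
    & par_eta a * (- dotv (grad (ffull phi) (tr_x s k)) (tr_p s k t)
                   - 2^-1 * dotv (tr_p s k t *m tr_B s k t) (tr_p s k t))
        <= ffull phi (tr_x s k) - ffull phi (tr_x s k.+1)].
Proof.
move=> [_ /(_ k)[_ _ _ [_ acc xS _ _]]] Nk Nnew.
have IE := card_full_sample Nnew; split=> //.
move: acc; rewrite -/t /step5_accepts Nk Nnew eqxx/= xS -/t.
rewrite /tr_m IE /model -/(ffull phi) mul0mx !dotv0r; lra.
Qed.

(** The chain is Polyak-Lojasiewicz, then the step decrease, then the acceptance test: the gap at
    x_k is bounded by the squared gradient, this by the model decrease, and this by the actual
    one. *)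
Lemma full_precision_descent s l c nu nubar (fstar : R) k (t := tr_T s k) :
  is_iretr_run phi h a s -> tr_N s k = N -> tr_Nnew s k t = N ->
  0 < par_eta a -> 0 < l -> 0 < c -> 0 <= nu <= nubar ->
  twice_differentiable (ffull phi) ->
  (forall z, loewner_le l%:M (hess (ffull phi) z)) ->
  (exists xstar, fstar = ffull phi xstar) ->
  loewner_le l%:M (tr_B s k t) -> loewner_le (tr_B s k t) c%:M ->
  tr_p s k t *m (tr_B s k t + nu%:M) = - grad (ffull phi) (tr_x s k) ->
  ffull phi (tr_x s k.+1) - fstar <=
    (1 - 2 * l * par_eta a / (4 * c + 2 * nubar)) * (ffull phi (tr_x s k) - fstar).
Proof.
move=> srun Nk Nnew eta0 l0 c0 nub fD lf [xstar ->] lB Bc pE.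
have [_ _ dec] := full_precision_pass srun Nk Nnew.
have H1 := regularized_step_decrease l0 c0 nub lB Bc pE.
have H2 := polyak_lojasiewicz (tr_x s k) xstar l0 fD lf.
have nb0 : 0 <= nubar by case/andP: nub => /le_trans; exact.
have C0 : 0 < 4 * c + 2 * nubar by lra.
have H3 := le_trans H2 H1.
have : 2 * l * par_eta a / (4 * c + 2 * nubar)
         * (ffull phi (tr_x s k) - ffull phi xstar)
       <= ffull phi (tr_x s k) - ffull phi (tr_x s k.+1).
  apply: le_trans dec.
  have E (x y z w : R) : x * y / z * w = y * (x * w / z).
    by rewrite mulrAC [x * y]mulrC -!mulrA.
  by rewrite E ler_pM2l// ler_pdivrMr// [leRHS]mulrC.
by rewrite mulrBl mul1r; lra.
Qed.

(** K is quantified before the run: it depends on Omega, k0, eps and the constants only, so one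
    index serves all sample paths. *)
Lemma full_precision_convergence l c nustar xstar (Omega : set 'rV[R]_n) k0 eps :
  0 < par_eta a < 1 -> 0 < l < c -> 0 < nustar < 1 -> 0 < eps ->
  twice_differentiable (ffull phi) ->
  (forall z, loewner_le l%:M (hess (ffull phi) z)) ->
  (forall z, ffull phi xstar <= ffull phi z) -> compact Omega ->
  exists K, (k0 <= K)%N /\ forall s (nu : nat -> R),
    is_iretr_run phi h a s -> (forall k, Omega (tr_x s k)) ->
    (forall k (t := tr_T s k), (k0 <= k)%N ->
      [/\ tr_N s k = N, tr_Nnew s k t = N, loewner_le l%:M (tr_B s k t)
        & loewner_le (tr_B s k t) c%:M]) ->
    (forall k (t := tr_T s k), (k0 <= k)%N ->
      [/\ 0 <= nu k, nu k / (l + nu k) <= nustar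
        & tr_p s k t *m (tr_B s k t + (nu k)%:M) = - grad (ffull phi) (tr_x s k)]) ->
    forall k, (K <= k)%N -> enorm (tr_x s k - xstar) <= eps.
Proof.
move=> /andP[eta0 eta1] /andP[l0 lc] /andP[ns0 ns1] eps0 fD lf fmin Oc.
have c0 : 0 < c by lra.
pose nubar := nustar * l / (1 - nustar).
have nb0 : 0 <= nubar by rewrite divr_ge0 ?subr_ge0 ?mulr_ge0// ltW.
pose q := 1 - 2 * l * par_eta a / (4 * c + 2 * nubar).
have C0 : 0 < 4 * c + 2 * nubar by lra.
(* Nonnegativity of q holds because eta < 1 and l < c make 2 l eta smaller than 4c. *)
have q01 : 0 <= q < 1.
  rewrite subr_ge0 gtrBl divr_gt0 ?mulr_gt0// ler_pdivrMr// mul1r andbT.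
  have : 2 * l * par_eta a <= 2 * l by rewrite ger_pMr ?mulr_gt0// ltW.
  lra.
have fc : continuous (ffull phi).
  by move=> z; apply: differentiable_continuous; case: fD.
have [M fM] := compact_ubound fc Oc.
(* The maximum with 1 makes this bound on the initial gap positive, so that it can be divided by. *)
pose M1 := Num.max 1 (M - ffull phi xstar).
have M10 : 0 < M1 by rewrite lt_max ltr01.
(* By quadratic growth, a gap of at most l eps^2 / 2 forces distance at most eps; J is the time at
   which q^j M1 falls below this level. *)
have tgt0 : 0 < 2^-1 * l * eps ^+ 2 / M1 by rewrite divr_gt0 ?mulr_gt0 ?exprn_gt0 ?invr_gt0.
have [J HJ] := geometric_decay q01 tgt0.
have q0 : 0 <= q by case/andP: q01.
exists (k0 + J)%N; split=> [|s nu srun sO full reg k]; first exact: leq_addr.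
have decay j : ffull phi (tr_x s (k0 + j)%N) - ffull phi xstar <= q ^+ j * M1.
  elim: j => [|j IH].
    by rewrite addn0 expr0 mul1r le_max lerD2r fM ?orbT.
  have k0j : (k0 <= k0 + j)%N := leq_addr _ _.
  have [Nk Nnew lB Bc] := full _ k0j; have [nu0 nus pE] := reg _ k0j.
  have nub : 0 <= nu (k0 + j)%N <= nubar by rewrite nu0 regularization_le.
  rewrite addnS; apply: le_trans (full_precision_descent srun Nk Nnew eta0 l0 c0
    nub fD lf (ex_intro _ xstar erefl) lB Bc pE) _.
  by rewrite exprS -[leRHS]mulrA; exact: (ler_wpM2l q0).
move=> Kk; have k0k : (k0 <= k)%N := leq_trans (leq_addr _ _) Kk.
have Jk : (J <= k - k0)%N by rewrite leq_subRL.
have := le_trans (quadratic_growth (tr_x s k) fD lf fmin) _.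
move=> /(_ (2^-1 * l * eps ^+ 2)) H.
have {}H : 2^-1 * l * enorm (tr_x s k - xstar) ^+ 2 <= 2^-1 * l * eps ^+ 2.
  apply: H; have := decay (k - k0)%N; rewrite subnKC// => /le_trans; apply.
  by rewrite -ler_pdivlMr// HJ.
move: H; rewrite ler_pM2l ?mulr_gt0 ?invr_gt0//.
by rewrite ler_pXn2r// nnegrE ?enorm_ge0// ltW.
Qed.

End Algorithm.

(** * Choice of the thresholds and contraction in expectation *)

Theorem theorem4p2 (R : realType) (N n : nat) (hN : (1 <= N)%N)
    (hn : (1 <= n)%N) (phi : 'I_N -> 'rV[R]_n -> R) (lambda1 lambdan : R)
    (hlambda : 0 < lambda1 < lambdan)
    (hC2 : forall i, C2 (phi i))
    (hspec : forall i x, loewner_le lambda1%:M (hess (phi i) x) /\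
                         loewner_le (hess (phi i) x) lambdan%:M)
    (xstar : 'rV[R]_n) (hxstar : unique_minimizer (ffull phi) xstar)
    (h : nat -> R) (hdecr : forall i j : nat, (i < j)%N -> h j < h i)
    (h1 : 0 < h 1%N) (hN0 : h N = 0)
    (a : iretr_data R n) (ha : valid_data N a) (haeps : par_eps_g a = 0)
    (LH : R) (nustar : R) (hnustar : 0 < nustar < 1) :
  exists dbar chibar pbar : R,
    [/\ 0 < dbar, 0 < chibar & 0 < pbar < 1] /\
    forall delta chiH pH : R,
      0 < delta <= dbar -> 0 < chiH <= chibar -> 0 < pH <= pbar ->
      hess_lipschitz_on_ball (ffull phi) xstar delta (2 * LH) ->
    forall (d : measure_display) (T : measurableType d) (P : probability T R)
      (run : T -> trace R N n)
      (D : T -> nat -> nat -> {set 'I_N})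
      (nu : T -> nat -> R)
      (Omega : set 'rV[R]_n),
      (forall w, is_iretr_run phi h a (run w)) ->
      (forall k, random_vector (fun w => tr_x (run w) k)) ->
      (forall k (A : {set 'I_N}),
         measurable [set w | D w k (tr_T (run w) k) = A]) ->
      compact Omega ->
      (forall w k, Omega (tr_x (run w) k)) ->
      (forall w k t, (t <= tr_T (run w) k)%N ->
         [/\ (1 <= #|D w k t| <= N)%N,
             tr_B (run w) k t = hess (favg phi (D w k t)) (tr_x (run w) k)
           & is_minimizer_on [set p | enorm p <= tr_Delta (run w) k t]
               (tr_m phi (run w) k t) (tr_p (run w) k t)]) ->
      (exists k0 : nat, forall w k, (k0 <= k)%N ->
         tr_N (run w) k = N /\
         forall t, (t <= tr_T (run w) k)%N -> tr_Nnew (run w) k t = N) ->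
      (forall w k (t := tr_T (run w) k),
         [/\ 0 <= nu w k,
             tr_p (run w) k t *m (tr_B (run w) k t + (nu w k)%:M)
               = - grad (favg phi (tr_Inew (run w) k t)) (tr_x (run w) k)
           & nu w k / (lambda1 + nu w k) <= nustar]) ->
      (forall k,
         cond_prob_ge P (fun w => tr_x (run w) k)
           [set w | opnorm (hess (ffull phi) (tr_x (run w) k)
                            - hess (favg phi (D w k (tr_T (run w) k)))
                                   (tr_x (run w) k)) <= chiH]
           (1 - pH)) ->
      exists taubar : R, 0 < taubar < 1 /\
        exists K : nat, forall k, (K <= k)%N ->
          ('E_P[(fun w => enorm (tr_x (run w) k.+1 - xstar)) : T -> R]
             <= taubar%:E
                * 'E_P[(fun w => enorm (tr_x (run w) k - xstar)) : T -> R])%E.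
Proof.
have /andP[l0 lc] := hlambda; have /andP[ns0 ns1] := hnustar.
have c0 : 0 < lambdan by lra.
have phiD i : twice_differentiable (phi i) by case: (hC2 i).
have [_ _ _ [_ [_ eta01 _]] _] := ha.
have NS : (0 < #|[set: 'I_N]%SET|)%N by rewrite cardsT card_ord.
have fD : twice_differentiable (ffull phi) := twice_differentiable_favg _ phiD.
have fspec x := hess_favg_spectrum x NS phiD hspec.
have lf x : loewner_le lambda1%:M (hess (ffull phi) x) by case: (fspec x).
have [fmin _] := hxstar.
have gstar : grad (ffull phi) xstar = 0 by apply: grad_minimizer; case: fD.
pose L := `|2 * LH|.
have L0 : 0 <= L by exact: normr_ge0.
pose r := 1 - nustar; have r0 : 0 < r by rewrite subr_gt0.
have r1 : r < 1 by rewrite /r; lra.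
pose dbar := r * lambda1 / (8 * (L + 1)).
pose chibar := r * lambda1 / 8.
(* The factor on the bad event is at most 2 (1 + lambdan / lambda1), so multiplying it by [pbar]
   gives r/4. *)
pose pbar := r / (8 * (1 + lambdan / lambda1)).
have cl0 : 0 < lambdan / lambda1 by rewrite divr_gt0.
have cancel8 (x y : R) : x != 0 -> x * (y / (8 * x)) = y / 8.
  by move=> x0; field.
have dbar0 : 0 < dbar by rewrite divr_gt0 ?mulr_gt0//; lra.
have chibar0 : 0 < chibar by rewrite divr_gt0 ?mulr_gt0.
have pbar0 : 0 < pbar by rewrite divr_gt0//; lra.
have pbar1 : pbar < 1 by rewrite ltr_pdivrMr; lra.
exists dbar, chibar, pbar; split; first by rewrite pbar0.
move=> delta chiH pH /andP[d0 dle] /andP[chi0 chile] /andP[p0 ple] lip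
  d T P run D nu Omega hrun hX _ Oc hO hB [k0 hk0] hnu hcond.
exists ((1 + nustar) / 2); split; first by apply/andP; split; lra.
have DB w k (t := tr_T (run w) k) :
    [/\ tr_B (run w) k t = hess (favg phi (D w k t)) (tr_x (run w) k),
        loewner_le lambda1%:M (tr_B (run w) k t)
      & loewner_le (tr_B (run w) k t) lambdan%:M].
  have [/andP[D0 _] BE _] := hB w k t (leqnn _).
  by have [] := hess_favg_spectrum (tr_x (run w) k) D0 phiD hspec; rewrite -BE.
have newton w k (t := tr_T (run w) k) : (k0 <= k)%N ->
    [/\ tr_x (run w) k.+1 = tr_x (run w) k + tr_p (run w) k t
      & tr_p (run w) k t *m (tr_B (run w) k t + (nu w k)%:M)
        = - grad (ffull phi) (tr_x (run w) k)].
  move=> k0k; have [Nk /(_ t (leqnn _)) Nnew] := hk0 w k k0k.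
  have [xE IE _] := full_precision_pass (hrun w) Nk Nnew.
  by have [_ + _] := hnu w k; rewrite -/t IE.
have [K [k0K HK]] := full_precision_convergence h k0 eta01 hlambda hnustar d0 fD lf fmin Oc.
exists K => k Kk; have k0k := leq_trans k0K Kk.
have near w : enorm (tr_x (run w) k - xstar) <= delta.
  apply: (HK (run w) (nu w)) => // j t k0j; last first.
    by have [_ pE] := newton w j k0j; have [nu0 _ nus] := hnu w j.
  have [Nj /(_ t (leqnn _)) Nnew] := hk0 w j k0j.
  by have [] := DB w j.
pose b chi := nustar + (chi + L * delta) / lambda1.
have step w chi (x := tr_x (run w) k) (t := tr_T (run w) k) : 0 <= chi ->
    enorm ((x - xstar) *m (hess (ffull phi) x - tr_B (run w) k t))
      <= chi * enorm (x - xstar) ->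
    enorm (tr_x (run w) k.+1 - xstar) <= b chi * enorm (x - xstar).
  move=> chi0' Hchi; have [xE pE] := newton w k k0k.
  have [_ lB _] := DB w k; have [nu0 _ nus] := hnu w k.
  rewrite xE addrAC.
  have tay := grad_taylor_le (proj2 fD) gstar lip (near w).
  have Z := regularized_step_contraction l0 nu0 nus lB pE tay L0 (near w) Hchi chi0'.
  exact: Z.
have Ld : L * delta / lambda1 <= r / 8.
  rewrite ler_pdivrMr//; apply: (@le_trans _ _ ((L + 1) * dbar)).
    by apply: ler_pM => //; [exact: ltW|lra].
  have L1 : L + 1 != 0 by rewrite gt_eqF// ltr_wpDl.
  by rewrite cancel8// mulrAC.
have bound_ge0 chi : 0 <= chi -> 0 <= b chi.
  by move=> chi0'; rewrite addr_ge0 ?(ltW ns0)// divr_ge0 ?(ltW l0)// addr_ge0// mulr_ge0// ltW.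
have := @expectation_le_cond R n d T P (fun w => tr_x (run w) k)
  (fun w => enorm (tr_x (run w) k.+1 - xstar)) _ pH (b chiH) (b (2 * lambdan)) xstar
  _ _ _ (hX k) (measurable_enorm xstar (hX k.+1)) (fun w => enorm_ge0 _) (hcond k) _ _.
move=> H; apply: le_trans (H _ _ _ _ _) _ => {H}.
- by rewrite (ltW p0)/=; lra.
- by rewrite bound_ge0 ?ltW.
- by rewrite bound_ge0 ?mulr_ge0 ?ltW.
- move=> w /= Hw; apply: step; first exact: ltW.
  have [-> _ _] := DB w k; apply: le_trans (enorm_mulmx_le _ _) _.
  by rewrite ler_wpM2r ?enorm_ge0.
(* Whatever the sample, both Hessians have spectrum in [lambda1, lambdan], so the triangle
   inequality gives the constant 2 lambdan. *)
- move=> w; apply: step; first by rewrite mulr_ge0// ltW.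
  have [_ lB Bc] := DB w k; have [lH Hc] := fspec (tr_x (run w) k).
  rewrite mulmxBr; apply: le_trans (enormD _ _) _; rewrite enormN.
  have := loewner_enorm_le (tr_x (run w) k - xstar) (ltW l0) c0 lB Bc.
  have := loewner_enorm_le (tr_x (run w) k - xstar) (ltW l0) c0 lH Hc.
  rewrite /ffull; lra.
(* The common expectation is nonnegative, which leaves a comparison of real coefficients. *)
apply: lee_wpmul2r; first by apply: expectation_ge0 => w; exact: enorm_ge0.
rewrite lee_fin.
have chil : chiH / lambda1 <= r / 8.
  by rewrite ler_pdivrMr// (le_trans chile)// /chibar mulrAC.
have b2 : b (2 * lambdan) <= 2 * (1 + lambdan / lambda1).
  by rewrite /b mulrDl -mulrA; lra.
have b2p : b (2 * lambdan) * pH <= r / 4.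
  apply: (@le_trans _ _ (2 * (1 + lambdan / lambda1) * pbar)).
    by apply: ler_pM => //; [apply: bound_ge0; lra|exact: ltW].
  rewrite /pbar; set y := 1 + _; have y0 : y != 0 by rewrite gt_eqF// /y; lra.
  by rewrite -mulrA cancel8//; lra.
have b1 : b chiH <= nustar + r / 8 + r / 8 by rewrite /b mulrDl; lra.
rewrite /r in b1 b2p; lra.
Qed.
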